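(* Let $k, n$ be integers such that $k \le n \le 2k$. Then (1) if $k$ is even and $n < 2k$, then $x(Q_{n/k}) = \frac{n}{k}$; and (2) if $k$ is odd, then $x(Q_{n/k}) = \frac{n+1}{k+1}$.
   Context: All graphs are finite, undirected, loopless, and have at least one edge. For $W \subseteq V(G)$, $\delta(W)$ denotes the set of edges of $G$ with exactly one end in $W$; a cut of $G$ is any edge set of the form $\delta(W)$. For positive integers $n,k$, an $n/k$-cover of $G$ is an $n$-tuple $(X_1,\dots,X_n)$ of cuts in $G$ (repetitions allowed) such that every edge of $G$ lies in at least $k$ of them. The fractional cut-covering number is $x(G) = \inf\{ n/k \mid \text{there exists an } n/k\text{-cover of } G\}$. The graph $Q_{n/k}$ (depending on the pair $(n,k)$) has vertex set $\{0,1\}^n$, and two vertices $u,v$ are adjacent iff their Hamming distance is at least $k$. *)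

(* Defs.v *)
From mathcomp Require Import classical_sets reals.
From mathcomp Require Import all_boot all_order all_algebra.

Set Implicit Arguments.
Unset Strict Implicit.
Unset Printing Implicit Defensive.

Import Order.TTheory GRing.Theory Num.Theory.

Local Open Scope ring_scope.

(* A graph is given by its adjacency relation [e] on a finite vertex type; the
   definitions below are meant for symmetric, irreflexive [e] with at least one
   edge. Parallel edges are irrelevant to cut covers. *)
Section CutCovers.
Variables (T : finType) (e : rel T).

(* An edge is identified with the set of its two ends. *)
Definition edges : {set {set T}} :=
  [set [set p.1; p.2] | p in [set p : T * T | e p.1 p.2]].

Definition delta (W : {set T}) : {set {set T}} :=
  [set f in edges | #|f :&: W| == 1%N].

Definition is_cut (F : {set {set T}}) : Prop := exists W, F = delta W.

Definition is_cover (n k : nat) (X : n.-tuple {set {set T}}) : Prop :=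
  (forall i : 'I_n, is_cut (tnth X i)) /\
  (forall f, f \in edges -> (k <= #|[set i : 'I_n | f \in tnth X i]|)%N).

Definition cover_ratios (R : realType) : set R :=
  [set q : R | exists n k : nat, [/\ (0 < n)%N, (0 < k)%N,
     exists X : n.-tuple {set {set T}}, is_cover k X
     & q = n%:R / k%:R]]%classic.

Arguments cover_ratios : clear implicits.

Definition frac_cut_cover (R : realType) : R := inf (cover_ratios R).

(* [inf] has a junk value unless [has_inf] holds. *)
Lemma cover_ratios_has_inf (R : realType) :
  irreflexive e -> (exists u v, e u v) -> has_inf (cover_ratios R).
Proof.
move=> e_irr [u0 [v0 _]]; split; last first.
  by exists 0 => _ [n [k [_ _ _ ->]]]; rewrite divr_ge0.
have T_gt0 : (0 < #|T|)%N by apply/card_gt0P; exists u0.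
exists (#|T|%:R / 1%:R), #|T|, 1%N; split => //.
exists [tuple delta [set enum_val i] | i < #|T|]; split=> [i|f fE].
  by exists [set enum_val i]; rewrite tnth_mktuple.
have /imsetP[[x y]] := fE; rewrite inE /= => exy fxy.
apply/card_gt0P; exists (enum_rank x).
rewrite inE tnth_mktuple enum_rankK inE fE /= fxy.
suff -> : [set x; y] :&: [set x] = [set x] by rewrite cards1.
by apply/setIidPr; rewrite sub1set !inE eqxx.
Qed.

End CutCovers.

Arguments cover_ratios {T} e R _.

Definition hamming (n : nat) (u v : n.-tuple bool) : nat :=
  #|[set i : 'I_n | tnth u i != tnth v i]|.

Definition Qgraph (n k : nat) : rel (n.-tuple bool) :=
  fun u v => (k <= hamming u v)%N.

Lemma Qgraph_sym n k : symmetric (@Qgraph n k).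
Proof.
move=> u v; rewrite /Qgraph /hamming; congr (_ <= _)%N.
by apply: eq_card => i; rewrite !inE eq_sym.
Qed.

Lemma Qgraph_irr n k : (0 < k)%N -> irreflexive (@Qgraph n k).
Proof.
move=> k_gt0 u; rewrite /Qgraph /hamming.
suff -> : [set i | tnth u i != tnth u i] = set0 by rewrite cards0 leqNgt k_gt0.
by apply/setP=> i; rewrite !inE eqxx.
Qed.

Lemma Qgraph_has_edge n k : (k <= n)%N -> exists u v, @Qgraph n k u v.
Proof.
move=> kn; exists [tuple false | i < n], [tuple true | i < n].
rewrite /Qgraph /hamming.
suff -> : [set i | tnth [tuple false | i < n] i != tnth [tuple true | i < n] i]
          = [set: 'I_n] by rewrite cardsT card_ord.
by apply/setP=> i; rewrite !inE !tnth_mktuple.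
Qed.

(* Main.v *)
Require Import Defs.
From mathcomp Require Import reals.
From mathcomp Require Import all_boot all_order all_algebra.
From mathcomp Require Import ring lra zify.

(** Upper bounds.  A map [c] from the vertices to words of length [N] such that
    the ends of every edge get words at distance at least [K] is the same thing
    as an [N/K]-cover: the [i]-th cut separates the vertices according to the
    [i]-th letter ([cover_ratios_code]).  The identity gives [n/k].  If [k] is
    odd, a parity letter raises the distances equal to [k] to [k + 1] and leaves
    the others at least [k + 1], which gives [(n + 1)/(k + 1)].

    Lower bounds.  Let [k] be even, [k <= n < 2k], and let [H] be the graph on
    the subsets of an [n]-element set in which [A] is joined to every [A + S]
    with [#|S| = k], where [+] is the symmetric difference.  No cut contains
    more than the fraction [k/n] of the edges of [H] ([sum_cut_le]), so counting
    the pairs (edge, cut containing it) bounds every cover ratio of [H] below by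
    [n/k], and the same holds for every graph to which [H] maps
    homomorphically ([cover_ratios_ge]).  In the even case [H] is a subgraph of
    the given graph.  In the odd case, [H] for the parameters [(n + 1, k + 1)]
    maps to it by forgetting a coordinate, as this lowers distances by at most
    one; moreover [n <= 2k] gives [n + 1 < 2(k + 1)].

    The cut fraction is a spectral estimate.  The characters of the group of
    subsets diagonalise [H], and the eigenvalue at [J] is the Krawtchouk number
    [K], the coefficient of ['X^k] in [(1 - 'X)^j (1 + 'X)^l], with [j = #|J|]
    and [l = n - j].  One needs [n K >= (n - 2k) 'C(n, k)], with equality for
    [j = 1].  For [j = 0] and, as [k] is even, for [j = n], the eigenvalue is
    ['C(n, k)].  Otherwise [n |K| <= (2k - n) 'C(n, k)] ([kraw_bound]), by
    induction on [n - k]: selecting one element of a [k]-set and one outside it,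
    and exchanging them, cancels the pairs with one element on each side of [J],
    which expresses [K] by Krawtchouk numbers for [(n - 2, k - 1)] ([kraw_rec]) and
    leaves [2k - n] unchanged. *)

Set Implicit Arguments.

Import Order.TTheory GRing.Theory Num.Theory.
Local Open Scope ring_scope.

(** * Krawtchouk numbers *)

Definition kpoly (R : nzRingType) (j l : nat) : {poly R} :=
  (1 - 'X) ^+ j * (1 + 'X) ^+ l.

(** The Krawtchouk number of order [k] and argument [j] for the length [j + l];
    its combinatorial meaning is [sum_chi_card]. *)
Definition kraw (R : nzRingType) (j l k : nat) : R := (kpoly R j l)`_k.

Lemma coef_exp_linear (R : comNzRingType) (c : R) n k :
  ((1 + c *: 'X) ^+ n)`_k = c ^+ k * 'C(n, k)%:R.
Proof.
rewrite addrC exprDn.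
under eq_bigr => i _ do rewrite expr1n mulr1 exprZn.
have -> : \sum_(i < n.+1) c ^+ (n - i) *: 'X^(n - i) *+ 'C(n, i) =
  \poly_(i < n.+1) (c ^+ i * 'C(n, i)%:R).
  rewrite poly_def (reindex_inj rev_ord_inj) /=; apply: eq_bigr => i _.
  rewrite subSS subKn ?leq_ord// bin_sub ?leq_ord//.
  by rewrite mulr_natr scalerMnl.
by rewrite coef_poly ltnS; case: leqP => // lk; rewrite bin_small ?mulr0.
Qed.

Lemma kraw0l (R : comNzRingType) l k : kraw R 0 l k = 'C(l, k)%:R.
Proof.
rewrite /kraw /kpoly expr0 mul1r -[X in 1 + X]scale1r coef_exp_linear.
by rewrite expr1n mul1r.
Qed.

Lemma krawj0 (R : comNzRingType) j k : kraw R j 0 k = (-1) ^+ k * 'C(j, k)%:R.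
Proof.
by rewrite /kraw /kpoly expr0 mulr1 -[X in 1 - X]scale1r -scaleNr coef_exp_linear.
Qed.

(** The differential equation that gives [kraw_rec] on coefficients.  After
    division by [(1 - 'X)^(j-2) (1 + 'X)^(l-2)] it is an identity of quadratic
    polynomials; the predecessors need separate cases for small [j] and [l]. *)
Lemma kpoly_ode (R : comNzRingType) j l :
  ((j + l)%:R - 1) * (kpoly R j l)^`() - 'X * (kpoly R j l)^`()^`() =
  (l * l.-1)%:R * kpoly R j l.-2 - (j * j.-1)%:R * kpoly R j.-2 l.
Proof.
have dY m : ((1 + 'X) ^+ m)^`() = m%:R * (1 + 'X) ^+ m.-1 :> {poly R}.
  by rewrite deriv_exp !derivE add0r mul1r mulr_natl.
have dZ m : ((1 - 'X) ^+ m)^`() = - m%:R * (1 - 'X) ^+ m.-1 :> {poly R}.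
  by rewrite deriv_exp !derivE sub0r mulN1r mulNrn mulNr mulr_natl.
have dN m : (m%:R : {poly R})^`() = 0 by rewrite -polyC_natr derivC.
rewrite /kpoly; rewrite !(derivM, dY, dZ, derivD, derivN, dN).
case: j => [|[|j]]; case: l => [|[|l]];
  rewrite /= ?(natrM, natrD, mulrSr, exprS, expr0, mulr0n,
    add0r, addr0, mul0r, mulr0, mulr1, oppr0, subr0); ring.
Qed.

(** On the coefficient of ['X^k] with [k = k'.+1], the operator of [kpoly_ode]
    acts as multiplication by [k (n - k)], where [n = j + l]. *)
Lemma kraw_rec (R : comNzRingType) j l k :
  k.+1%:R * ((j + l)%:R - k.+1%:R) * kraw R j l k.+1 =
  (l * l.-1)%:R * kraw R j l.-2 k - (j * j.-1)%:R * kraw R j.-2 l k.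
Proof.
have := congr1 (fun p : {poly R} => p`_k) (@kpoly_ode R j l).
rewrite /kraw -[1]/(1%:R) -!polyC_natr -polyCB !coefB !coefCM => <-.
rewrite coefXM !coef_deriv.
set c := (_)`_k.+1.
rewrite [if _ then _ else _](_ : _ = c *+ k.+1 *+ k); last first.
  by case: k @c => [|k].
move: (c) => d.
rewrite natrD -[_ *+ k]mulr_natr -[d *+ _]mulr_natr -natr1.
move: (j%:R) (l%:R) (k%:R) => a b e; ring.
Qed.

(** The number is a sum of ['C(j + l, k)] signs. *)
Lemma kraw_le_bin (R : realDomainType) j l k :
  `|kraw R j l k| <= 'C(j + l, k)%:R.
Proof.
elim: l k => [|l IHl] k.
  by rewrite krawj0 normrM normrX normrN1 expr1n mul1r normr_nat addn0.
have -> : kraw R j l.+1 k =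
  kraw R j l k + (if k is k'.+1 then kraw R j l k' else 0).
  rewrite /kraw /kpoly exprSr mulrA mulrDr mulr1 coefD coefMX; congr (_ + _).
  by case: k.
case: k => [|k]; first by rewrite addr0 (le_trans (IHl _))// !bin0.
by rewrite (le_trans (ler_normD _ _))// addnS binS natrD lerD.
Qed.

(** This bounds a term of [kraw_rec] to which the induction hypothesis applies,
    with [s] the length [n - 2]. *)
Lemma falling_weight_le (R : realFieldType) s t (z d : R) :
  (t <= s)%N -> 0 <= z -> s%:R * z <= d -> (t * t.-1)%:R * z <= t.-1%:R * d.
Proof.
move=> ts z0 hz; rewrite natrM mulrAC mulrC ler_wpM2l//.
by rewrite (le_trans _ hz)// ler_wpM2r// ler_nat.
Qed.

(** The arithmetic of the induction step of [kraw_bound], with [s = n - 2].  The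
    induction hypothesis gives [s * x <= d] only for [2 < j], as the smaller
    numbers then have both arguments positive; for [j = 2] one has the weaker
    [x <= d], and for [j = 1] the coefficient of [x] vanishes.  When
    [j = l = 2], two weak bounds are not sufficient, hence the extra hypothesis
    for that case. *)
Lemma pair_weight_le (R : realFieldType) s j l (x y d : R) :
  (j + l = s.+2)%N -> (0 < j <= l)%N -> (0 < s)%N ->
  0 <= x -> 0 <= y -> 0 <= d ->
  (j = 2%N -> l = 2%N -> 2 * y + 2 * x <= 3 * d) ->
  (j = 2%N -> x <= d) -> (l = 2%N -> y <= d) ->
  ((2 < j)%N -> s%:R * x <= d) -> ((2 < l)%N -> s%:R * y <= d) ->
  (l * l.-1)%:R * y + (j * j.-1)%:R * x <= s.+1%:R * d.
Proof.
move=> jlE /andP[j0 jl] s0; case: (ltngtP j 2%N) => j2.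
- have -> : j = 1%N by lia.
  have lE : l = s.+1 by lia.
  move=> x0 y0 d0 _ _ hy2 _ hy; rewrite muln0 mul0r addr0 lE natrM -mulrA.
  rewrite ler_wpM2l//; have [l2|l2] := leqP l 2; last exact: hy.
  have s1 : s = 1%N by clear -lE l2 s0; lia.
  by rewrite s1 mul1r hy2// lE s1.
- have -> : s.+1 = (l.-1 + j.-1 + 1)%N by lia.
  have [ls js l2] : [/\ l <= s, j <= s & 2 < l]%N by split; lia.
  move=> x0 y0 d0 _ _ _ hx hy; rewrite 2!natrD [leRHS]mulrDl mul1r ler_wpDr//.
  rewrite [leRHS]mulrDl.
  by rewrite lerD ?(@falling_weight_le _ s) ?hx ?hy.
- have lE : l = s by lia.
  move=> x0 y0 d0 h22 hx2 hy2 hx hy.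
  have [l2|l2] := leqP l 2.
    have s2 : s = 2 by clear -lE l2 jl j2; lia.
    by move: (h22 j2); rewrite j2 lE s2; apply.
  have -> : s.+1%:R = s.-1%:R + 2 :> R by rewrite -natrD addn2 prednK.
  rewrite [leRHS]mulrDl; apply: lerD; last by rewrite j2 muln1 ler_wpM2l// hx2.
  by rewrite -lE; apply: falling_weight_le (leqnn _) y0 _; rewrite {1}lE hy.
Qed.

(** Equality holds for [j = 1].  The induction is on [m = n - k], with [n = k + m]:
    [kraw_rec] lowers [k] and [m] by one, so that [k - m = 2k - n] is constant.
    The condition [m < k] is essential, since for [m = k] the right side is zero
    and not all Krawtchouk numbers are. *)
Lemma kraw_bound (R : realFieldType) m k j l :
  (0 < j)%N -> (0 < l)%N -> (j + l = k + m)%N -> (m < k)%N ->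
  (k + m)%:R * `|kraw R j l k| <= (k - m)%:R * 'C(k + m, k)%:R.
Proof.
elim: m k j l => [|m IHm] [|k] j l // j0 l0 jlE mk.
  have := @kraw_le_bin R j l k.+1; rewrite jlE subn0 addn0 => ?.
  by rewrite ler_wpM2l.
(* [kraw_rec] for [j = 0] is the absorption identity of binomials. *)
have kC : k.+1%:R * m.+1%:R * 'C(k.+1 + m.+1, k.+1)%:R =
    (k.+1 + m.+1)%:R * (k + m).+1%:R * 'C(k + m, k)%:R :> R.
  have := @kraw_rec R 0 (k.+1 + m.+1) k; rewrite !kraw0l mul0n mul0r subr0 add0n.
  by rewrite -natrB ?leq_addr// addKn => ->; rewrite addSn addnS natrM.
set n := (k.+1 + m.+1)%N in jlE kC *.
set c : R := 'C(k + m, k)%:R in kC.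
have nE : n = (k + m).+2 by rewrite /n addSn addnS.
have c0 : 0 <= c by [].
rewrite subSS; pose r : R := (k - m)%:R.
have r1 : 1 <= r by rewrite ler1n subn_gt0.
pose x := `|kraw R j.-2 l k|; pose y := `|kraw R j l.-2 k|.
have rec : k.+1%:R * m.+1%:R * `|kraw R j l k.+1| <=
    (l * l.-1)%:R * y + (j * j.-1)%:R * x.
  have := @kraw_rec R j l k; rewrite jlE natrD [_ + _ - _]addrAC subrr add0r.
  move=> /(congr1 Num.norm); rewrite !normrM !normr_nat => ->.
  by rewrite (le_trans (ler_normB _ _))// !normrM !normr_nat.
have hx2 : j = 2%N -> x = c.
  move=> j2; rewrite /x j2 kraw0l normr_nat /c.
  by have -> : l = (k + m)%N by clear -j2 jlE nE; lia.
have hy2 : l = 2%N -> y = c.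
  move=> l2; rewrite /y l2 krawj0 normrM normrX normrN1 expr1n mul1r normr_nat.
  by rewrite /c; have -> : j = (k + m)%N by clear -l2 jlE nE; lia.
have hx3 : (2 < j)%N -> (k + m)%:R * x <= r * c.
  by move=> j2; apply: IHm => //; clear -j2 jlE nE; lia.
have hy3 : (2 < l)%N -> (k + m)%:R * y <= r * c.
  by move=> l2; apply: IHm => //; clear -l2 jlE nE; lia.
have rc0 : 0 <= r * c by rewrite mulr_ge0.
have x0 : 0 <= x by rewrite normr_ge0.
have y0 : 0 <= y by rewrite normr_ge0.
have c_rc : c <= r * c by rewrite ler_peMl.
suff key : (l * l.-1)%:R * y + (j * j.-1)%:R * x <= (k + m).+1%:R * (r * c).
  rewrite -(@ler_pM2l _ (k.+1%:R * m.+1%:R)) ?mulr_gt0 ?ltr0n//.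
  rewrite mulrCA [leRHS]mulrCA kC -[n%:R * _ * _]mulrA [leRHS]mulrCA.
  by rewrite ler_wpM2l// (le_trans rec)// (le_trans key)// mulrCA.
(* [r = k - m] has the parity of [k + m], so it is at least 2 here. *)
have four : (k + m = 2)%N -> 2 * c + 2 * c <= 3 * (r * c).
  move=> km; have -> : r = 2.
    by rewrite /r; have -> : (k - m = 2)%N by clear -km mk; lia.
  by lra.
have [jl|lj] := leqP j l.
  apply: pair_weight_le => //.
  - by rewrite jlE nE.
  - by rewrite j0.
  - exact: leq_trans (leq_ltn_trans (leq0n m) mk) (leq_addr _ _).
  - by move=> j2 l2; rewrite hx2// hy2// four//; clear -j2 l2 jlE nE; lia.
  - by move=> /hx2 ->.
  - by move=> /hy2 ->.
rewrite addrC; apply: pair_weight_le => //.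
- by rewrite addnC jlE nE.
- by rewrite l0 ltnW.
- exact: leq_trans (leq_ltn_trans (leq0n m) mk) (leq_addr _ _).
- by move=> j2 l2; rewrite hy2// hx2// four//; clear -j2 l2 jlE nE; lia.
- by move=> /hy2 ->.
- by move=> /hx2 ->.
Qed.

(** * Fourier analysis on the group of subsets *)

Definition symdiff (I : finType) (A B : {set I}) : {set I} :=
  [set i | (i \in A) (+) (i \in B)].

Definition chi (R : pzRingType) (I : finType) (J A : {set I}) : R :=
  \prod_(i in A) (-1) ^+ (i \in J).

Lemma in_symdiff (I : finType) (A B : {set I}) i :
  (i \in symdiff A B) = (i \in A) (+) (i \in B).
Proof. by rewrite inE. Qed.

Lemma symdiff0 (I : finType) (A : {set I}) : symdiff A set0 = A.
Proof. by apply/setP=> i; rewrite !inE addbF. Qed.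

Lemma symdiff_eq0 (I : finType) (A B : {set I}) :
  (symdiff A B == set0) = (A == B).
Proof.
apply/eqP/eqP=> [/setP AB|->]; apply/setP=> i; last by rewrite !inE addbb.
by have := AB i; rewrite !inE; do 2!case: (i \in _).
Qed.

Lemma chiM (R : comPzRingType) (I : finType) (J A B : {set I}) :
  chi R J (symdiff A B) = chi R J A * chi R J B.
Proof.
rewrite /chi [in LHS]big_mkcond [X in _ = X * _]big_mkcond.
rewrite [X in _ = _ * X]big_mkcond -big_split; apply: eq_bigr => i _ /=.
rewrite in_symdiff; case: (i \in A); case: (i \in B); rewrite ?mul1r ?mulr1//=.
by rewrite -signr_addb addbb.
Qed.

Lemma chi_sym (R : comPzRingType) (I : finType) (J A : {set I}) :
  chi R J A = chi R A J.
Proof.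
rewrite /chi big_mkcond [RHS]big_mkcond; apply: eq_bigr => i _.
by case: (i \in A); case: (i \in J).
Qed.

Lemma sum_chi (R : comPzRingType) (I : finType) (A : {set I}) :
  \sum_(J : {set I}) chi R J A = if A == set0 then 2 ^+ #|I| else 0.
Proof.
under eq_bigr => J _ do rewrite chi_sym /chi big_mkcond.
rewrite -(bigA_distr _ _ (fun i => (-1) ^+ (i \in A)) (fun=> 1)) /=.
case: eqP => [->|/eqP/set0Pn[i iA]].
  under eq_bigr => i _ do rewrite inE.
  by rewrite prodr_const cardT -cardE.
by rewrite (bigD1 i)//= iA expr1 addNr mul0r.
Qed.

(** Both sides are the coefficient of ['X^k] in the product over all [i] of
    [1 - 'X] for [i] in [J] and [1 + 'X] for [i] outside [J]. *)
Lemma sum_chi_card (R : comNzRingType) (I : finType) (J : {set I}) k :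
  \sum_(A : {set I} | #|A| == k) chi R J A = kraw R #|J| #|~: J| k.
Proof.
pose F i : {poly R} := (-1) ^+ (i \in J) * 'X.
have FE (A : {set I}) : \prod_(i in A) F i = (chi R J A)%:P * 'X^#|A|.
  rewrite big_split prodr_const /chi rmorph_prod; congr (_ * _).
  by apply: eq_bigr => i _; rewrite rmorph_sign.
have -> : kraw R #|J| #|~: J| k = (\prod_i (F i + 1))`_k.
  rewrite /kraw; congr (polyseq _)`_k.
  rewrite /kpoly (bigID (mem J)) /=; congr (_ * _).
    rewrite -prodr_const; apply: eq_bigr => i iJ.
    by rewrite /F iJ mulN1r addrC.
  rewrite -prodr_const; apply: eq_big => [i|i]; rewrite inE// => iJ.
  by rewrite /F (negbTE iJ) mul1r addrC.
rewrite bigA_distr coef_sum big_mkcond; apply: eq_bigr => A _.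
by rewrite -big_mkcond FE coefCM coefXn eq_sym; case: eqP; rewrite ?mulr1 ?mulr0.
Qed.

(** The least eigenvalue of the graph that joins sets whose symmetric difference
    has [k] elements.  Evenness of [k] enters only for [J] the full set, where
    the eigenvalue is [(-1)^k 'C(n, k)]. *)
Lemma sum_chi_card_ge (R : realFieldType) (I : finType) (J : {set I}) k :
  ~~ odd k -> (k <= #|I|)%N -> (#|I| < 2 * k)%N ->
  (#|I|%:R - 2 * k%:R) * 'C(#|I|, k)%:R <=
    #|I|%:R * \sum_(A : {set I} | #|A| == k) chi R J A.
Proof.
move=> k_even kI Ik; rewrite sum_chi_card.
have JI : (#|J| + #|~: J| = #|I|)%N by rewrite cardsC.
have extreme : (#|I|%:R - 2 * k%:R) * 'C(#|I|, k)%:R <=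
    #|I|%:R * 'C(#|I|, k)%:R :> R.
  by rewrite ler_wpM2r// lerBlDr lerDl mulr_ge0.
case: (posnP #|J|) => J0.
  by rewrite J0 kraw0l (_ : #|~: J| = #|I|) // -JI J0.
case: (posnP #|~: J|) => JC0.
  rewrite JC0 krawj0 -signr_odd (negbTE k_even) expr0 mul1r (_ : #|J| = #|I|) //.
  by rewrite -JI JC0 addn0.
have [m mE] : exists m, #|I| = (k + m)%N by exists (#|I| - k)%N; rewrite subnKC.
have mk : (m < k)%N by move: Ik; rewrite mE mul2n -addnn ltn_add2l.
have := @kraw_bound R m k _ _ J0 JC0; rewrite JI mE => /(_ erefl mk).
rewrite natrB 1?ltnW// natrD; set K := kraw _ _ _ _ => h.
have : (k%:R + m%:R) * - K <= (k%:R - m%:R) * 'C(k + m, k)%:R.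
  apply: le_trans h; rewrite -(normrN K).
  by apply: ler_wpM2l (ler_norm _); rewrite addr_ge0.
by lra.
Qed.

(** Convolution becomes multiplication on the Fourier side: expanding the square,
    the sum over [J] retains the pairs of sets that differ by [S]. *)
Lemma fourier_correlation (R : comPzRingType) (I : finType) (f : {set I} -> R) S :
  \sum_J (\sum_A f A * chi R J A) ^+ 2 * chi R J S =
  2 ^+ #|I| * \sum_A f A * f (symdiff A S).
Proof.
transitivity (\sum_A \sum_B f A * f B *
    \sum_J chi R J (symdiff (symdiff A S) B)).
  under [RHS]eq_bigr => A _.
    under eq_bigr => B _ do rewrite mulr_sumr.
    rewrite exchange_big/=; over.
  rewrite [RHS]exchange_big/=; apply: eq_bigr => J _.
  rewrite expr2 -mulrA mulr_suml; apply: eq_bigr => A _.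
  rewrite mulrCA mulr_suml; apply: eq_bigr => B _.
  rewrite !chiM; ring.
rewrite mulr_sumr; apply: eq_bigr => A _.
rewrite (bigD1 (symdiff A S))//= sum_chi symdiff_eq0 eqxx big1 ?addr0 1?mulrC//.
by move=> B; rewrite sum_chi symdiff_eq0 eq_sym => /negPf ->; rewrite mulr0.
Qed.

(** Expand [f] in characters and bound each eigenvalue from below; Parseval's
    identity is [fourier_correlation] at the empty set. *)
Lemma correlation_ge (R : realFieldType) (I : finType) k (f : {set I} -> R) :
  ~~ odd k -> (k <= #|I|)%N -> (#|I| < 2 * k)%N ->
  (#|I|%:R - 2 * k%:R) * 'C(#|I|, k)%:R * \sum_A f A ^+ 2 <=
  #|I|%:R * \sum_A \sum_(S : {set I} | #|S| == k) f A * f (symdiff A S).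
Proof.
move=> k_even kI Ik; rewrite -(@ler_pM2l _ (2 ^+ #|I|)) ?exprn_gt0//.
pose F J := (\sum_A f A * chi R J A) ^+ 2.
have -> : 2 ^+ #|I| * (#|I|%:R *
      \sum_A \sum_(S : {set I} | #|S| == k) f A * f (symdiff A S)) =
    \sum_J F J * (#|I|%:R * \sum_(S : {set I} | #|S| == k) chi R J S).
  rewrite mulrCA; under [RHS]eq_bigr => J _ do rewrite mulrCA mulr_sumr.
  rewrite -mulr_sumr [in RHS]exchange_big [in LHS]exchange_big /= mulr_sumr.
  by congr (_ * _); apply: eq_bigr => S _; rewrite fourier_correlation.
have -> : 2 ^+ #|I| * ((#|I|%:R - 2 * k%:R) * 'C(#|I|, k)%:R * \sum_A f A ^+ 2) =
    \sum_J F J * ((#|I|%:R - 2 * k%:R) * 'C(#|I|, k)%:R).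
  rewrite -mulr_suml mulrCA [RHS]mulrC; congr (_ * _).
  have := @fourier_correlation _ _ f set0.
  under eq_bigr => J _ do rewrite [chi _ _ set0]big_set0 mulr1.
  by move=> ->; congr (_ * _); apply: eq_bigr => A _; rewrite symdiff0 expr2.
by apply: ler_sum => J _; rewrite ler_wpM2l ?sqr_ge0// sum_chi_card_ge.
Qed.

(** Apply [correlation_ge] to the function with values 1 and -1 on the two sides
    of the cut: each edge contributes -1 if it is cut and 1 otherwise. *)
Lemma sum_cut_le (R : realFieldType) (I : finType) k (g : {set I} -> bool) :
  ~~ odd k -> (k <= #|I|)%N -> (#|I| < 2 * k)%N ->
  #|I|%:R * \sum_A \sum_(S : {set I} | #|S| == k) (g A != g (symdiff A S))%:R <=
  k%:R * \sum_(A : {set I}) \sum_(S : {set I} | #|S| == k) 1 :> R.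
Proof.
move=> k_even kI Ik.
have := @correlation_ge R I k (fun A => (-1) ^+ g A) k_even kI Ik.
have -> : \sum_A \sum_(S : {set I} | #|S| == k) (-1) ^+ g A * (-1) ^+ g (symdiff A S) =
   \sum_(A : {set I}) \sum_(S : {set I} | #|S| == k) 1 -
   2 * \sum_A \sum_(S : {set I} | #|S| == k) (g A != g (symdiff A S))%:R :> R.
  rewrite mulr_sumr -sumrB; apply: eq_bigr => A _.
  rewrite mulr_sumr -sumrB; apply: eq_bigr => S _.
  by rewrite -signr_addb -negb_eqb; case: (g A != _) => /=; ring.
under eq_bigr do rewrite sqrr_sign.
have -> : \sum_(A : {set I}) \sum_(S : {set I} | #|S| == k) 1 =
  'C(#|I|, k)%:R * \sum_(A : {set I}) 1 :> R.
  rewrite mulr_sumr; apply: eq_bigr => A _; rewrite mulr1 -card_draws.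
  by rewrite -sum1_card natr_sum; apply: eq_bigl => S; rewrite inE.
lra.
Qed.

(** * Cuts and covers *)

Lemma mem_delta (T : finType) (e : rel T) (W : {set T}) u v :
  irreflexive e -> e u v ->
  ([set u; v] \in delta e W) = ((u \in W) != (v \in W)).
Proof.
move=> e_irr euv; have uv : u != v by apply: contraTneq euv => ->; rewrite e_irr.
have uvE : [set u; v] \in edges e by apply/imsetP; exists (u, v); rewrite ?inE.
rewrite inE uvE setIUl /= cardsU.
have -> : [set u] :&: W :&: ([set v] :&: W) = set0.
  by apply/setP=> w; rewrite !inE; case: eqP => // ->; rewrite (negbTE uv) andbF.
rewrite cards0 subn0.
have card1I w : #|[set w] :&: W| = (w \in W).
  case: (boolP (w \in W)) => wW.
    by rewrite (setIidPl _) ?sub1set// cards1.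
  by apply/eqP; rewrite cards_eq0 setI_eq0 disjoints1.
by rewrite !card1I; do 2!case: (_ \in W).
Qed.

Lemma cover_separates (T : finType) (e : rel T) n k (X : n.-tuple {set {set T}}) :
  irreflexive e -> is_cover e k X ->
  exists W : 'I_n -> {set T}, forall u v, e u v ->
    (k <= #|[set i | (u \in W i) != (v \in W i)]|)%N.
Proof.
move=> e_irr [/fin_all_exists[W WX] kX]; exists W => u v euv.
have uvE : [set u; v] \in edges e by apply/imsetP; exists (u, v); rewrite ?inE.
apply: leq_trans (kX _ uvE) _; apply: subset_leq_card; apply/subsetP => i.
by rewrite !inE WX mem_delta.
Qed.

Lemma cover_ratios_code (R : realType) (T : finType) (e : rel T) n k
    (c : T -> n.-tuple bool) :
  irreflexive e -> (0 < n)%N -> (0 < k)%N ->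
  (forall u v, e u v -> (k <= hamming (c u) (c v))%N) ->
  cover_ratios e R (n%:R / k%:R).
Proof.
move=> e_irr n0 k0 ck; exists n, k; split=> //.
exists [tuple delta e [set u | tnth (c u) i] | i < n]; split=> [i|f fE].
  by exists [set u | tnth (c u) i]; rewrite tnth_mktuple.
have /imsetP[[u v]] := fE; rewrite inE /= => euv fuv.
apply: leq_trans (ck _ _ euv) _; apply: subset_leq_card; apply/subsetP => i.
by rewrite !inE tnth_mktuple fuv mem_delta// !inE.
Qed.

(** A weak duality argument: the pairs [(A, S)] with [#|S| = k] are the oriented
    edges of a graph that [psi] maps into [e].  Every cut takes at most the
    fraction [k / #|I|] of them, and an [n'/k']-cover cuts each of them at least
    [k'] times. *)
Lemma cover_ratios_ge (R : realType) (T : finType) (e : rel T) (I : finType) k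
    (psi : {set I} -> T) q :
  irreflexive e -> ~~ odd k -> (k <= #|I|)%N -> (#|I| < 2 * k)%N ->
  (forall A S : {set I}, #|S| = k -> e (psi A) (psi (symdiff A S))) ->
  cover_ratios e R q -> #|I|%:R / k%:R <= q.
Proof.
move=> e_irr k_even kI Ik psi_e.
move=> [n' [k' [n0 k0 [X /(cover_separates e_irr)[W kW] ->]]]].
pose D : R := \sum_(A : {set I}) \sum_(S : {set I} | #|S| == k) 1.
pose cut i : R := \sum_A \sum_(S : {set I} | #|S| == k)
  ((psi A \in W i) != (psi (symdiff A S) \in W i))%:R.
have kpos : (0 < k)%N by case: (k) Ik; rewrite ?muln0.
have D0 : 0 < D.
  have /set0Pn[S] : [set S : {set I} | #|S| == k] != set0.
    by rewrite -card_gt0 card_draws bin_gt0.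
  rewrite inE => Sk; rewrite /D (bigD1 set0)//=.
  apply: ltr_wpDr; first by apply: sumr_ge0 => A _; apply: sumr_ge0.
  by rewrite (bigD1 S)//=; apply: ltr_wpDr => //; apply: sumr_ge0.
have kD : k'%:R * D <= \sum_i cut i.
  rewrite exchange_big /= /D mulr_sumr ler_sum// => A _.
  rewrite exchange_big /= mulr_sumr ler_sum// => S /eqP Sk.
  rewrite mulr1 -natr_sum ler_nat (leq_trans (kW _ _ (psi_e A S Sk)))//.
  by rewrite -sum1_card big_mkcond leq_sum// => i _; rewrite inE; case: ifP.
have cutD i : #|I|%:R * cut i <= k%:R * D.
  exact: (@sum_cut_le R I k (fun A => psi A \in W i) k_even kI Ik).
have le : #|I|%:R * (k'%:R * D) <= n'%:R * (k%:R * D).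
  apply: le_trans (ler_wpM2l _ kD) _; rewrite // mulr_sumr.
  apply: le_trans (ler_sum _ (fun i _ => cutD i)) _.
  by rewrite sumr_const card_ord [leRHS]mulr_natl.
rewrite ler_pdivrMr ?ltr0n// mulrAC ler_pdivlMr ?ltr0n//.
by rewrite -(ler_pM2r D0) -!mulrA.
Qed.

Lemma frac_cut_cover_eq (R : realType) (T : finType) (e : rel T) q :
  cover_ratios e R q -> (forall q', cover_ratios e R q' -> q <= q') ->
  frac_cut_cover e R = q.
Proof.
move=> qe lbq; apply/eqP; rewrite eq_le; apply/andP; split.
  by apply: ge_inf => //; exists q.
by apply: lb_le_inf; [exists q | move=> q'; exact: lbq].
Qed.

(** * The parity letter *)

Lemma hamming_cons n b b' (u v : n.-tuple bool) :
  hamming [tuple of b :: u] [tuple of b' :: v] = ((b != b') + hamming u v)%N.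
Proof.
rewrite /hamming -!sum1_card big_mkcond big_ord_recl inE !tnth0; congr (_ + _)%N.
rewrite [RHS]big_mkcond; apply: eq_bigr => i _.
by rewrite !inE !tnthS.
Qed.

Lemma odd_hamming n (u v : n.-tuple bool) :
  odd (hamming u v) = odd (count id u) (+) odd (count id v).
Proof.
elim: n u v => [|n IHn] u v.
  rewrite (tuple0 u) (tuple0 v) /hamming cardsE eq_card0// => i; by case: i.
case/tupleP: u => b u; case/tupleP: v => b' v.
rewrite hamming_cons !oddD IHn /= ?oddD.
by rewrite ?oddb; case: b; case: b';
  case: (odd (count id u)); case: (odd (count id v)).
Qed.

(** * The cut-covering number *)

Theorem theorem4p2 (R : realType) (k n : nat)
    (hkn : (k <= n)%N) (hnk : (n <= 2 * k)%N) :
  (~~ odd k -> (n < 2 * k)%N ->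
     frac_cut_cover (@Qgraph n k) R = n%:R / k%:R) /\
  (odd k ->
     frac_cut_cover (@Qgraph n k) R = (n%:R + 1) / (k%:R + 1)).
Proof.
split=> [k_even n2k | k_odd].
  have k0 : (0 < k)%N by case: (k) n2k; rewrite ?muln0.
  apply: frac_cut_cover_eq.
    apply: (@cover_ratios_code _ _ _ _ _ id) => //; first exact: Qgraph_irr.
    exact: leq_trans k0 hkn.
  move=> q; have -> : n%:R = #|'I_n|%:R :> R by rewrite card_ord.
  apply: (@cover_ratios_ge _ _ _ _ _ (fun A => [tuple i \in A | i < n])).
  - exact: Qgraph_irr.
  - by [].
  - by rewrite card_ord.
  - by rewrite card_ord.
  move=> A S <-; rewrite /Qgraph /hamming subset_leq_card//; apply/subsetP => i iS.
  by rewrite inE !tnth_mktuple in_symdiff iS; case: (i \in A).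
have k0 : (0 < k)%N by case: (k) k_odd.
rewrite !natr1; apply: frac_cut_cover_eq.
  apply: (@cover_ratios_code _ _ _ _ _
    (fun u : n.-tuple bool => [tuple of odd (count id u) :: u])) => //.
    exact: Qgraph_irr.
  (* The parity letters differ exactly when the distance is odd. *)
  move=> u v; rewrite /Qgraph hamming_cons leq_eqVlt => /predU1P[kE|].
    by rewrite negb_eqb -odd_hamming -kE k_odd.
  by move=> /leq_trans; apply; exact: leq_addl.
move=> q; have -> : n.+1%:R = #|'I_n.+1|%:R :> R by rewrite card_ord.
(* The coordinate [ord0] of the [n.+1] coordinates is forgotten. *)
apply: (@cover_ratios_ge _ _ _ _ _ (fun A => [tuple lift ord0 i \in A | i < n])).
- exact: Qgraph_irr.
- by rewrite /= k_odd.
- by rewrite card_ord.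
- by rewrite card_ord mulnS add2n !ltnS.
move=> A S Sk; rewrite /Qgraph /hamming -ltnS -Sk.
rewrite (cardsD1 ord0) -[leqRHS]add1n leq_add ?leq_b1//.
rewrite -(card_imset _ (@lift_inj n.+1 ord0)) subset_leq_card//.
apply/subsetP => i; rewrite !inE; case: (unliftP ord0 i) => [j ->|->//].
move=> /andP[_ jS]; apply: imset_f.
by rewrite inE !tnth_mktuple in_symdiff jS; case: (_ \in A).
Qed.
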